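(* Consider the Gaussian linear model $y=X\beta_0+\varepsilon$, $\varepsilon\sim N_n(0,\sigma_0^2I_n)$ with known $\sigma_0^2$. Suppose the guidance vector $\tilde z^*$ and the active set $A_n$ are measurable with respect to a screening $\sigma$-field generated by auxiliary data independent of $y$ (so that, conditionally, they are fixed). Assume (A1), (A2), (A4), (A5), (A6), (A9), (A11) (see context) and: (B1) $A_n\supseteq\{j:|\hat\beta^{\mathrm{init}}_j|>t_n\}\cup\{j:\tilde z^*_j>u_n\}$ for a screening statistic $\hat\beta^{\mathrm{init}}$ and thresholds $t_n,u_n$; (B2) there are $r_n>t_n$, $q_n>u_n$ with $P(\min_{j\in S_0}|\hat\beta^{\mathrm{init}}_j|\ge r_n)\to1$ and $P(\min_{j\in S_0}\tilde z_j^*\ge q_n)\to1$; (B3) there is $L_n$, growing at most polylogarithmically in $p$, and $C>0$ with $P(|A_n|\le Cs_0L_n)\to1$; (B4) with $m_n=Cs_0L_n$, $\bar\epsilon_n^2=s_0\log m_n/n$, for all sufficiently large $M$ there are tests $\phi_n$ with $E_{\beta_0}\phi_n\to0$ and $\sup_{A\supseteq S_0,|A|\le m_n}\ \sup_{\beta\in\Theta(A),\|\beta-\beta_0\|_2\ge M\bar\epsilon_n}E_\beta(1-\phi_n)\le\exp(-c_T(M)n\bar\epsilon_n^2)$. Assume further that $s_0\log m_n\to\infty$; that the restricted priors satisfy, for a constant $C_F>0$ and all $A\in\mathcal A_n$, sets $\mathcal F_{n,A}\subseteq\Theta(A)$ with $\Pi_A(\mathcal F_{n,A}^c\mid\tilde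 z^* )\le e^{-C_Fn\bar\epsilon_n^2}$; that for a constant $C_D>0$ and every $\delta>0$ there are events $\Omega_{n,A}$ with $\sup_{A\in\mathcal A_n}P_{\beta_0}(\Omega^c_{n,A})\to0$ on which $\int_{\Theta(A)}\frac{f_\beta(y)}{f_{\beta_0}(y)}d\Pi_A(\beta\mid\tilde z^* )\ge e^{-(C_D+\delta)n\bar\epsilon_n^2}$; and that $\min\{c_T(M),C_F\}>C_D$ for all sufficiently large $M$. Then for all sufficiently large $M>0$, $$\Pi_{A_n}\big(\|\beta-\beta_0\|_2\ge M\bar\epsilon_n\,\big|\,y,\tilde z^*\big)\to0\quad\text{in }P_{\beta_0}\text{-probability}.$$
   Context: $S_0=\{j:\beta_{0j}\ne0\}$, $s_0=|S_0|$, $p=p_n$. Assumptions: (A1) $s_0\log p=o(n)$, $s_0\log p\to\infty$; (A2) there are $\phi_0>0$, $K\ge1$ with $\|Xv\|_2^2\ge n\phi_0^2\|v\|_2^2$ for all $v$ with at most $Ks_0$ nonzero entries; (A4) $\max_j|\tilde z_j^*|\le C_z$; (A5) $\max_{j\in S_0}|\beta_{0j}|\le B$; (A6) hyperparameters $\tau_0,a_c,b_c,\sigma_\eta$ fixed positive constants; (A9) $p_n\to\infty$, $\log p_n=o(n)$; (A11) $\|X\|_{\mathrm{op}}=O(\sqrt n)$. $\mathcal A_n=\{A\subseteq\{1,\dots,p\}:S_0\subseteq A,\ |A|\le m_n\}$, $\Theta(A)=\{\beta\in\mathbb R^p:\beta_j=0\ \forall j\notin A\}$. $f_\beta$ is the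 $N_n(X\beta,\sigma_0^2I_n)$ density; $E_\beta$, $P_{\beta_0}$ refer to $y\sim N_n(X\beta,\sigma_0^2I_n)$. Guided prior: $\kappa^2(z;\lambda,\tau,c,\eta)=\dfrac{c^2\tau^2\lambda^2e^{\eta z}}{c^2+\tau^2\lambda^2e^{\eta z}}$; independently $\lambda_j\sim C^+(0,1)$, $\tau\sim C^+(0,\tau_0)$, $c^2\sim\mathrm{IG}(a_c,b_c)$, $\eta\sim N^+(0,\sigma_\eta^2)$, and $\beta_j\sim N(0,\sigma_0^2\kappa^2(\tilde z_j^*;\lambda_j,\tau,c,\eta))$. $\Pi_A(\cdot\mid\tilde z^* )$ uses this hierarchy only for $j\in A$ and sets $\beta_j=0$ for $j\notin A$. The active posterior is $\Pi_{A}(B\mid y,\tilde z^* )=\int_{B\cap\Theta(A)}f_\beta(y)\,d\Pi_A(\beta\mid\tilde z^* )\big/\int_{\Theta(A)}f_\beta(y)\,d\Pi_A(\beta\mid\tilde z^* )$, evaluated at $A=A_n$. *)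

(* Defs.v *)
From HB Require Import structures.
From mathcomp Require Import all_boot all_order all_algebra.
From mathcomp Require Import all_classical all_reals all_analysis.
Set Implicit Arguments. Unset Strict Implicit. Unset Printing Implicit Defensive.
Import Order.TTheory GRing.Theory Num.Theory.
Import numFieldNormedType.Exports.
Local Open Scope classical_set_scope.
Local Open Scope ring_scope.

Section Defs.
Context {R : realType}.

(** Vectors of R^k are k-tuples (MathComp-Analysis equips [k.-tuple R] with
    the product sigma-algebra generated by the coordinates). *)
Definition vadd k (v w : k.-tuple R) : k.-tuple R := [tuple tnth v i + tnth w i | i < k].
Definition vsub k (v w : k.-tuple R) : k.-tuple R := [tuple tnth v i - tnth w i | i < k].
Definition norm2 k (v : k.-tuple R) : R := Num.sqrt (\sum_(i < k) tnth v i ^+ 2).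
Definition vsupp k (v : k.-tuple R) : {set 'I_k} := [set j | tnth v j != 0].

Definition mulX n p (X : 'M[R]_(n, p)) (v : p.-tuple R) : n.-tuple R :=
  [tuple \sum_(j < p) X i j * tnth v j | i < n].

Definition lik n p (sigma0 : R) (X : 'M[R]_(n, p)) (beta : p.-tuple R) (y : n.-tuple R) : R :=
  (Num.sqrt (pi *+ 2 * sigma0 ^+ 2))^-1 ^+ n
  * expR (- (norm2 (vsub y (mulX X beta))) ^+ 2 / (sigma0 ^+ 2 *+ 2)).

Definition inTheta p (A : {set 'I_p}) (b : p.-tuple R) : Prop :=
  forall j, j \notin A -> tnth b j = 0.

Definition posR : set R := [set x | 0 < x].
Definition halfcauchy (s : R) (B : set R) : \bar R :=
  (\int[lebesgue_measure]_(x in B `&` posR) (2 * s / (pi * (s ^+ 2 + x ^+ 2)))%:E)%E.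
Definition halfnormal (s : R) (B : set R) : \bar R :=
  (2%:E * normal_prob 0 s (B `&` posR))%E.
Definition ig_kernel (a b x : R) : R := powR x (- a - 1) * expR (- b / x).
Definition invgamma (a b : R) (B : set R) : \bar R :=
  (fine (\int[lebesgue_measure]_(x in B `&` posR) (ig_kernel a b x)%:E)%E
   / fine (\int[lebesgue_measure]_(x in posR) (ig_kernel a b x)%:E)%E)%:E.

(** kappa^2(z; lambda, tau, c, eta), with [c2] standing for c^2 *)
Definition kappa2 (z lam tau c2 eta : R) : R :=
  c2 * tau ^+ 2 * lam ^+ 2 * expR (eta * z) / (c2 + tau ^+ 2 * lam ^+ 2 * expR (eta * z)).

(** The guided prior restricted to A, realised on a prior probability space:
    beta_j = sigma0 * kappa_j * xi_j (xi_j ~ N(0,1) independent of the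
    hyperparameters), i.e. beta_j | hyper ~ N(0, sigma0^2 kappa_j^2), for j in A,
    and beta_j = 0 for j notin A. *)
Definition prior_beta p (sigma0 : R) (z : p.-tuple R) (A : {set 'I_p})
  (lam xi : p.-tuple R) (tau c2 eta : R) : p.-tuple R :=
  [tuple if j \in A then sigma0 * Num.sqrt (kappa2 (tnth z j) (tnth lam j) tau c2 eta) * tnth xi j
         else 0 | j < p].

Definition guided_prior_law {dT} {Th : measurableType dT} (Q : probability Th R) p
  (tau0 a_c b_c sigma_eta : R)
  (lam xi : Th -> p.-tuple R) (tau c2 eta : Th -> R) : Prop :=
  (measurable_fun setT lam /\ measurable_fun setT xi /\ measurable_fun setT tau /\
   measurable_fun setT c2 /\ measurable_fun setT eta) /\
  forall (Bl Bx : 'I_p -> set R) (Bt Bc Be : set R),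
    (forall j, measurable (Bl j)) -> (forall j, measurable (Bx j)) ->
    measurable Bt -> measurable Bc -> measurable Be ->
    Q [set th | (forall j, Bl j (tnth (lam th) j)) /\ (forall j, Bx j (tnth (xi th) j))
               /\ Bt (tau th) /\ Bc (c2 th) /\ Be (eta th)]
    = ((\prod_(j < p) halfcauchy 1 (Bl j)) * (\prod_(j < p) normal_prob 0 1 (Bx j))
       * halfcauchy tau0 Bt * invgamma a_c b_c Bc * halfnormal sigma_eta Be)%E.

Definition iid_gauss_noise {dO} {O : measurableType dO} (P : probability O R) n
  (sigma0 : R) (eps : O -> n.-tuple R) : Prop :=
  measurable_fun setT eps /\
  forall B : 'I_n -> set R, (forall i, measurable (B i)) ->
    P [set w | forall i, B i (tnth (eps w) i)] = (\prod_(i < n) normal_prob 0 sigma0 (B i))%E.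

Definition active_posterior {dT} {Th : measurableType dT} (Q : probability Th R) n p
  (sigma0 : R) (X : 'M[R]_(n, p)) (beta0 : p.-tuple R)
  (lam xi : Th -> p.-tuple R) (tau c2 eta : Th -> R)
  (z : p.-tuple R) (A : {set 'I_p}) (y : n.-tuple R) (rad : R) : R :=
  let b th := prior_beta sigma0 z A (lam th) (xi th) (tau th) (c2 th) (eta th) in
  fine (\int[Q]_th ((if rad <= norm2 (vsub (b th) beta0) then 1 else 0)
                      * lik sigma0 X (b th) y)%:E)%E
  / fine (\int[Q]_th (lik sigma0 X (b th) y)%:E)%E.

Definition evidence {dT} {Th : measurableType dT} (Q : probability Th R) n p
  (sigma0 : R) (X : 'M[R]_(n, p)) (beta0 : p.-tuple R)
  (lam xi : Th -> p.-tuple R) (tau c2 eta : Th -> R)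
  (z : p.-tuple R) (A : {set 'I_p}) (y : n.-tuple R) : \bar R :=
  (\int[Q]_th (lik sigma0 X (prior_beta sigma0 z A (lam th) (xi th) (tau th) (c2 th) (eta th)) y
               / lik sigma0 X beta0 y)%:E)%E.

(** E_beta g(y) for y ~ N_n(X beta, sigma0^2 I_n), realised as y = X beta + eps. *)
Definition Ebeta {dO} {O : measurableType dO} (P : probability O R) n p
  (X : 'M[R]_(n, p)) (eps : O -> n.-tuple R) (beta : p.-tuple R) (g : n.-tuple R -> R) : \bar R :=
  (\int[P]_w (g (vadd (mulX X beta) (eps w)))%:E)%E.

Definition in_calA p (S0 : {set 'I_p}) (m : R) (A : {set 'I_p}) : Prop :=
  S0 \subset A /\ (#|A|%:R <= m).

End Defs.

(* Main.v *)
Require Import Defs.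
From HB Require Import structures.
From mathcomp Require Import all_boot all_order all_algebra.
From mathcomp Require Import all_classical all_reals all_analysis.
From mathcomp Require Import measurable_realfun ring lra.
Import Order.TTheory GRing.Theory Num.Theory.
Import numFieldNormedType.Exports.
Local Open Scope classical_set_scope.
Local Open Scope ring_scope.

(** The posterior mass of the ball complement is a ratio of prior averages of the
    likelihood ratios [f_b / f_beta0]. On the evidence event the denominator is at least
    [exp (- (CD + delta) n eb^2)]. Weighting the numerator by [1 - phi_n] and taking the
    expectation under [beta0], Tonelli and the change of measure
    [E_beta0 (g f_b / f_beta0) = E_b g] bound it by the type II errors, that is by
    [exp (- cT(M) n eb^2)]. Markov's inequality then gives, for a fixed outcome of the
    screening, a bound on the probability that the posterior mass exceeds [e] by
    [P (Om^c) + 2 E_beta0 phi_n + (2 / e) exp (- delta n eb^2)], with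
    [delta = (cT(M) - CD) / 2]. Each term vanishes; since the evidence events are
    controlled only pointwise in the screening outcome, dominated convergence is used to
    average over it, on the event that the active set contains the support and is small. *)

(** * Weighted laws and product laws *)

Lemma measurable_forall_fin {d : measure_display} {T : measurableType d} (I : finType)
    (A : I -> set T) :
  (forall i, measurable (A i)) -> measurable [set x | forall i, A i x].
Proof.
move=> mA; rewrite (_ : [set x | _] = \bigcap_(i in [set: I]) A i).
  by apply: fin_bigcap_measurable => // i _; exact: mA.
by apply/seteqP; split=> x Ax i; [move=> _|]; exact: Ax.
Qed.

Section transfer.
Context {R : realType} {d1 d2 : measure_display}.
Context {T : measurableType d1} {U : measurableType d2}.
Variables (mu : {measure set T -> \bar R}) (nu : {measure set U -> \bar R}).
Variables (w : T -> R) (Y : T -> U) (C : R).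
Hypotheses (w0 : forall x, 0 <= w x) (mw : measurable_fun setT w).
Hypotheses (mY : measurable_fun setT Y).
Hypothesis muYE : forall B, measurable B ->
  (\int[mu]_x (w x * \1_B (Y x))%:E = C%:E * nu B)%E.

Import HBNNSimple.

Let measurable_weighted (g : U -> R) : measurable_fun setT g ->
  measurable_fun setT (fun x => (w x * g (Y x))%:E : \bar R).
Proof.
move=> mg; apply/measurable_EFinP/measurable_funM => //.
exact: measurableT_comp.
Qed.

Let nnsfun_transfer (g : {nnsfun U >-> R}) :
  (\int[mu]_x (w x * g (Y x))%:E = C%:E * \int[nu]_u (g u)%:E)%E.
Proof.
transitivity (\sum_(r \in range g)
  (\int[mu]_x (w x * (r * \1_(g @^-1` [set r]) (Y x)))%:E))%E.
  rewrite -ge0_integral_fsum//.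
  - apply: eq_integral => x _; rewrite fsumEFin//; congr (_%:E).
    by rewrite [in LHS]fimfunE mulr_fsumr.
  - move=> r; apply: (@measurable_weighted (fun u => r * \1_(g @^-1` [set r]) u)).
    by apply: measurable_funM => //; exact: measurable_indic.
  - by move=> r x _; rewrite lee_fin mulr_ge0//; have := nnfun_muleindic_ge0 g r (Y x).
transitivity (\sum_(r \in range g)
  (C%:E * \int[nu]_u (r * \1_(g @^-1` [set r]) u)%:E))%E.
  apply: eq_fsbigr => r; rewrite inE => -[u _ <-].
  have gu0 : 0 <= g u by [].
  under eq_integral do rewrite mulrCA EFinM.
  rewrite ge0_integralZl//; last 2 first.
    - by apply: measurable_weighted; exact: measurable_indic.
    - by move=> x _; rewrite lee_fin mulr_ge0.
  rewrite muYE//; under [in RHS]eq_integral do rewrite EFinM.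
  rewrite ge0_integralZl//; last exact/measurable_EFinP/measurable_indic.
  by rewrite integral_indic// setIT muleCA.
rewrite -ge0_mule_fsumr; last first.
  by move=> r; apply: integral_ge0 => u _; have := nnfun_muleindic_ge0 g r u.
rewrite -ge0_integral_fsum//.
- congr (C%:E * _)%E; apply: eq_integral => u _.
  by rewrite [in RHS]fimfunE fsumEFin.
- by move=> r; apply/measurable_EFinP/measurable_funM => //; exact: measurable_indic.
- by move=> r u _; have := nnfun_muleindic_ge0 g r u.
Qed.

Lemma ge0_integral_transfer (f : U -> R) :
  (forall u, 0 <= f u) -> measurable_fun setT f ->
  (\int[mu]_x (w x * f (Y x))%:E = C%:E * \int[nu]_u (f u)%:E)%E.
Proof.
move=> f0 mf.
have mEf : measurable_fun setT (EFin \o f) by exact/measurable_EFinP.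
pose g := nnsfun_approx measurableT mEf.
have gf u : EFin \o g ^~ u @ \oo --> (f u)%:E.
  by apply: cvg_nnsfun_approx => // ? _; rewrite lee_fin.
have g_nd u : {homo g ^~ u : a b / (a <= b)%N >-> a <= b}.
  by move=> a b ab; exact/lefP/nd_nnsfun_approx.
have cvg_mu : (\int[mu]_x (w x * g n (Y x))%:E)%E @[n --> \oo]
    --> (\int[mu]_x (w x * f (Y x))%:E)%E.
  rewrite [X in _ --> X](_ : _ =
      (\int[mu]_x limn (fun n => (w x * g n (Y x))%:E))%E); last first.
    apply: eq_integral => x _; apply/esym/cvg_lim => //.
    under eq_fun do rewrite EFinM.
    by rewrite EFinM; apply: cvgeZl => //; exact: gf.
  apply: cvg_monotone_convergence => //.
  - by move=> n; exact: measurable_weighted.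
  - by move=> n x _; rewrite lee_fin mulr_ge0.
  - by move=> x _ a b ab; rewrite lee_fin ler_wpM2l// g_nd.
have cvg_nu : (\int[nu]_u (g n u)%:E)%E @[n --> \oo]
    --> (\int[nu]_u (f u)%:E)%E.
  rewrite [X in _ --> X](_ : _ = (\int[nu]_u limn (fun n => (g n u)%:E))%E); last first.
    by apply: eq_integral => u _; apply/esym/cvg_lim => //; exact: gf.
  apply: cvg_monotone_convergence => //.
  - by move=> n; exact/measurable_EFinP.
  - by move=> n u _; rewrite lee_fin.
  - by move=> u _ a b ab; rewrite lee_fin g_nd.
rewrite -(cvg_lim _ cvg_mu)//; apply/cvg_lim => //.
by under eq_fun do rewrite nnsfun_transfer; exact: cvgeZl.
Qed.

End transfer.

Section gaussian_shift.
Context {R : realType}.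
Local Notation mu := (@lebesgue_measure R).

Let measurable_addr (a : R) :
  measurable_fun setT ((fun x => x + a)%R : measurableTypeR R -> measurableTypeR R).
Proof. exact: measurable_funD. Qed.

Lemma lebesgue_measure_shift (a : R) (A : set R) : measurable A ->
  pushforward mu ((fun x => x + a)%R : measurableTypeR R -> measurableTypeR R) A = mu A.
Proof.
move=> mA; apply/esym; apply: lebesgue_measure_unique => //=.
move=> _ [[b c]] _ <-; rewrite /pushforward.
rewrite (_ : _ @^-1` _ = `]b - a, c - a]%classic); last first.
  by apply/seteqP; split=> x /=; rewrite !in_itv/= ltrBlDr lerBrDr.
rewrite !lebesgue_measure_itv/= !lte_fin ltrD2r.
by case: ifPn => // _; rewrite -!EFinB opprB addrA addrNK.
Qed.

Lemma ge0_integral_shift (a : R) (f : R -> \bar R) :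
  measurable_fun setT f -> (forall x, 0 <= f x)%E ->
  (\int[mu]_x f (x + a)%R = \int[mu]_x f x)%E.
Proof.
move=> mf f0.
transitivity (\int[pushforward mu
    ((fun x => x + a)%R : measurableTypeR R -> measurableTypeR R)]_x f x)%E.
  by rewrite ge0_integral_pushforward.
by apply: eq_measure_integral => A mA _; exact: lebesgue_measure_shift.
Qed.

Lemma ge0_integral_normal_prob (m s : R) (f : R -> R) :
  (forall x, 0 <= f x) -> measurable_fun setT f ->
  (\int[normal_prob m s]_x (f x)%:E = \int[mu]_x (normal_pdf m s x * f x)%:E)%E.
Proof.
move=> f0 mf.
rewrite (@ge0_integral_transfer _ _ _ _ _ mu (normal_prob m s) (normal_pdf m s) id 1)//.
- by rewrite mul1e.
- exact: normal_pdf_ge0.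
- exact: measurable_normal_pdf.
- move=> B mB; rewrite mul1e /= /normal_prob [RHS]integral_mkcond/=.
  by apply: eq_integral => x _; rewrite patchE indicE; case: ifPn; rewrite ?mulr1 ?mulr0.
Qed.

Definition normal_shift_weight (s a x : R) : R :=
  expR ((x ^+ 2 - (x - a) ^+ 2) / (s ^+ 2 *+ 2)).

Lemma measurable_normal_shift_weight s a :
  measurable_fun setT (normal_shift_weight s a).
Proof.
apply: measurableT_comp => //; apply: measurable_funM => //.
by apply: measurable_funB; apply: measurable_funX => //; exact: measurable_funB.
Qed.

Lemma normal_pdf_shift (s a x : R) : s != 0 ->
  normal_pdf 0 s x * normal_shift_weight s a x = normal_pdf 0 s (x - a).
Proof.
move=> s0; rewrite !normal_pdfE// /normal_fun /normal_shift_weight -mulrA -expRD.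
by rewrite !subr0 !mulNr mulrBl addrA addNr add0r.
Qed.

Lemma normal_prob_shift (s a : R) (B : set R) : s != 0 -> measurable B ->
  (\int[normal_prob 0 s]_x (\1_B x * normal_shift_weight s a x)%:E =
   normal_prob 0 s [set x | B (x + a)%R])%E.
Proof.
move=> s0 mB; rewrite ge0_integral_normal_prob; last 2 first.
  - by move=> x; rewrite mulr_ge0// expR_ge0.
  - by apply: measurable_funM; [exact: measurable_indic|exact: measurable_normal_shift_weight].
under eq_integral do rewrite mulrCA normal_pdf_shift//.
rewrite -(@ge0_integral_shift a)//; last 2 first.
  - apply/measurable_EFinP/measurable_funM; first exact: measurable_indic.
    apply: measurableT_comp; first exact: measurable_normal_pdf.
    exact: measurable_funB.
  - by move=> x; rewrite lee_fin mulr_ge0// normal_pdf_ge0.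
rewrite /normal_prob [RHS]integral_mkcond; apply: eq_integral => x _.
rewrite addrK patchE indicE.
have -> : (x \in [set y | B (y + a)]) = (x + a \in B) by [].
by case: (x + a \in B); rewrite ?mul1r ?mul0r.
Qed.

End gaussian_shift.

Section product_law.
Context {R : realType} {d d' : measure_display}.
Context {O : measurableType d} {U : measurableType d'} {n : nat}.
Variables (P : probability O R) (nu : probability U R) (eps : O -> n.-tuple U).
Hypothesis meps : measurable_fun setT eps.
Hypothesis epsE : forall B : 'I_n -> set U, (forall i, measurable (B i)) ->
  P [set w | forall i, B i (tnth (eps w) i)] = (\prod_(i < n) nu (B i))%E.

Let measurable_eps i : measurable_fun setT (fun w => tnth (eps w) i).
Proof. by move: i; apply/measurable_fun_tnthP. Qed.

(* The indicators are replaced by general functions one coordinate at a time: with the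
   other factors fixed, the weighted law of coordinate [k] is a multiple of [nu]. *)
Let integral_prod_law_indic k (f : 'I_n -> U -> R) (c : 'I_n -> R) :
  (forall i u, 0 <= f i u) -> (forall i, measurable_fun setT (f i)) ->
  (forall i, \int[nu]_u (f i u)%:E = (c i)%:E)%E ->
  (forall i : 'I_n, (k <= i)%N -> exists2 B, measurable B & f i = \1_B) ->
  (\int[P]_w (\prod_(i < n) f i (tnth (eps w) i))%:E = (\prod_(i < n) c i)%:E)%E.
Proof.
elim: k f c => [|k IH] f c f0 mf fc find.
  have {find} /choice[B BP] : forall i, exists B, measurable B /\ f i = \1_B.
    by move=> i; have [B mB fB] := find i (leq0n _); exists B.
  have mE : measurable [set w | forall i, B i (tnth (eps w) i)].
    apply: measurable_forall_fin => i.
    by rewrite -[X in measurable X]setTI; apply: measurable_eps => //; exact: (BP i).1.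
  transitivity (P [set w | forall i, B i (tnth (eps w) i)]).
    rewrite -[X in P X]setIT -integral_indic//.
    apply: eq_integral => w _; congr (_%:E).
    rewrite indicE; case: (asboolP ([set w | forall i, B i (tnth (eps w) i)] w)) => [Ew|nEw].
      by rewrite (mem_set Ew) big1// => i _; rewrite (BP i).2 indicE mem_set//; exact: Ew.
    have /existsNP[i nBi] : ~ forall i, B i (tnth (eps w) i) by [].
    by rewrite memNset// (bigD1 i)//= (BP i).2 indicE memNset// mul0r.
  rewrite epsE => [|i]; last exact: (BP i).1.
  apply: (big_ind2 (fun x y => x = y%:E)) => // [x _ y _ -> ->//|i _].
  by rewrite -fc (BP i).2 integral_indic ?setIT//; exact: (BP i).1.
have [nk|kn] := leqP n k.
  by apply: IH => // i ki; have := ltn_ord i; rewrite ltnNge (leq_trans nk).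
pose j := Ordinal kn.
under eq_integral do rewrite (bigD1 j)//= mulrC.
rewrite (@ge0_integral_transfer _ _ _ _ _ P nu
  (fun w => \prod_(i < n | i != j) f i (tnth (eps w) i))
  (fun w => tnth (eps w) j) (\prod_(i < n | i != j) c i))//.
- by rewrite fc [in RHS](bigD1 j)//= -EFinM mulrC.
- by move=> w /=; apply: prodr_ge0 => i _; exact: f0.
- apply: (eq_measurable_fun (fun w =>
      \prod_(i <- [seq i <- index_enum 'I_n | i != j]) f i (tnth (eps w) i))).
    by move=> w _; rewrite big_filter.
  by apply: measurable_prod => i _; exact: measurableT_comp.
move=> B mB.
pose f' i := if i == j then \1_B else f i.
pose c' i := if i == j then fine (nu B) else c i.
have := IH f' c'; rewrite (bigD1 j)//= /c' eqxx EFinM fineK ?fin_num_measure//.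
rewrite muleC => IHB.
rewrite (eq_bigr (fun i => if i == j then fine (nu B) else c i)); last first.
  by move=> i /negPf ->.
rewrite -IHB {IHB}.
- apply: eq_integral => w _; congr (_%:E).
  rewrite [RHS](bigD1 j)//= [RHS]mulrC /f' eqxx; congr (_ * _).
  by apply: eq_bigr => i /negPf ->.
- by move=> i u; rewrite /f'; case: ifP.
- by move=> i; rewrite /f'; case: ifP => // _; exact: measurable_indic.
- move=> i; rewrite /f'; case: ifP => // _.
  by rewrite integral_indic// setIT fineK// fin_num_measure.
- move=> i ki; rewrite /f'; case: ifPn => [_|ij]; first by exists B.
  by apply: find; rewrite ltn_neqAle ki andbT; apply: contra ij => /eqP kE; apply/eqP/val_inj.
Qed.

Lemma integral_prod_law (f : 'I_n -> U -> R) (c : 'I_n -> R) :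
  (forall i u, 0 <= f i u) -> (forall i, measurable_fun setT (f i)) ->
  (forall i, \int[nu]_u (f i u)%:E = (c i)%:E)%E ->
  (\int[P]_w (\prod_(i < n) f i (tnth (eps w) i))%:E = (\prod_(i < n) c i)%:E)%E.
Proof.
move=> f0 mf fc; apply: (@integral_prod_law_indic n) => // i ni.
by have := ltn_ord i; rewrite ltnNge ni.
Qed.

End product_law.

Section weighted_law.
Context {R : realType} {d1 d2 : measure_display}.
Context {T : measurableType d1} {U : measurableType d2}.
Variables (mu : {measure set T -> \bar R}) (w : T -> R) (Y : T -> U).
Hypotheses (w0 : forall x, 0 <= w x) (mw : measurable_fun setT w).
Hypothesis mY : measurable_fun setT Y.

Lemma weighted_law_measure : exists m : {measure set U -> \bar R},
  forall B, m B = (\int[mu]_(x in Y @^-1` B) (w x)%:E)%E.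
Proof.
pose f (B : set U) := (\int[mu]_(x in Y @^-1` B) (w x)%:E)%E.
have f_0 : f set0 = 0%E by rewrite /f preimage_set0 integral_set0.
have f_ge0 B : (0 <= f B)%E by apply: integral_ge0 => x _; rewrite lee_fin.
have f_additive : semi_sigma_additive f.
  move=> A mA tA mUA; rewrite /f preimage_bigcup ge0_integral_bigcup//.
  - by apply: is_cvg_ereal_nneg_natsum_cond => k _ _; exact: f_ge0.
  - by move=> k; rewrite -[X in measurable X]setTI; exact: mY.
  - by apply/measurable_EFinP; exact: measurable_funTS.
  - by move=> x _; rewrite lee_fin.
  - by apply/trivIsetP => i j _ _ ij; rewrite -preimage_setI ((trivIsetP.1 tA) i j)// preimage_set0.
pose m : {measure set U -> \bar R} := HB.pack f (isMeasure.Build _ _ _ f f_0 f_ge0 f_additive).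
by exists m.
Qed.

End weighted_law.

Section tuple_rectangles.
Context {d : measure_display} {T : measurableType d} {n : nat}.

Definition tuple_rectangle : set (set (n.-tuple T)) :=
  [set A | exists2 B : 'I_n -> set T, (forall i, measurable (B i)) &
                                      A = [set v | forall i, B i (tnth v i)]].

Lemma setI_closed_tuple_rectangle : setI_closed tuple_rectangle.
Proof.
move=> _ _ [B mB ->] [C mC ->]; exists (fun i => B i `&` C i).
  by move=> i; exact: measurableI.
by apply/seteqP; split=> v /= => [[Bv Cv] i|BCv]; [|split=> i; have [] := BCv i].
Qed.

Lemma measurable_tuple_rectangleE :
  @measurable _ (n.-tuple T) = <<s tuple_rectangle >>.
Proof.
apply/seteqP; split; last first.
  apply: smallest_sub; first exact: sigma_algebra_measurable.
  move=> _ [B mB ->]; apply: measurable_forall_fin => i.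
  by rewrite -[X in measurable X]setTI; exact: measurable_tnth.
apply: smallest_sub; first exact: smallest_sigma_algebra.
move=> A; rewrite -bigcup_seq => -[i _ [B mB <-]].
apply: sub_sigma_algebra; exists (fun j => if j == i then B else setT).
  by move=> j; case: ifP.
apply/seteqP; split=> v /=.
  by move=> [_ Bv] j; case: eqP => // ->.
by move=> /(_ i); rewrite eqxx.
Qed.

End tuple_rectangles.

(** * The Gaussian linear model *)

Section model_measurability.
Context {R : realType} {d : measure_display} {T : measurableType d}.

Lemma measurable_invr : measurable_fun [set: R] (@GRing.inv R).
Proof.
apply: (eq_measurable_fun (fun x : R =>
    if 0 < x then expR (- ln x) else if x < 0 then - expR (- ln (- x)) else 0)).
  move=> x _; have [x0|x0|<-] := ltgtP 0 x.
  - by rewrite expRN lnK.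
  - by rewrite expRN lnK ?posrE ?oppr_gt0// invrN opprK.
  - by rewrite invr0.
apply: measurable_fun_ifT => //; first exact: measurable_fun_ltr.
  by apply: measurableT_comp => //; apply: measurable_funN; exact: measurable_ln.
apply: measurable_fun_ifT => //; first exact: measurable_fun_ltr.
apply: measurable_funN; apply: measurableT_comp => //; apply: measurable_funN.
by apply: (measurableT_comp (@measurable_ln R)).
Qed.

Lemma measurable_funV (f : T -> R) :
  measurable_fun setT f -> measurable_fun setT (fun t => (f t)^-1).
Proof. by move=> mf; exact: (measurableT_comp measurable_invr). Qed.

Lemma measurable_fun_sqrt (f : T -> R) :
  measurable_fun setT f -> measurable_fun setT (fun t => Num.sqrt (f t)).
Proof.
move=> mf; apply: (measurableT_comp _ mf).
by apply: continuous_measurable_fun => x; exact: sqrt_continuous.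
Qed.

Lemma measurable_fun_tuple {k : nat} (f : T -> k.-tuple R) (F : 'I_k -> T -> R) :
  (forall t i, tnth (f t) i = F i t) -> (forall i, measurable_fun setT (F i)) ->
  measurable_fun setT f.
Proof.
move=> fE mF; apply/measurable_fun_tnthP => i.
by apply: (eq_measurable_fun (F i)) => // t _; rewrite -fE.
Qed.

Lemma measurable_fun_tnth {k : nat} (f : T -> k.-tuple R) i :
  measurable_fun setT f -> measurable_fun setT (fun t => tnth (f t) i).
Proof. by move=> mf; move: i; apply/measurable_fun_tnthP. Qed.

Lemma measurable_vadd {k : nat} (f g : T -> k.-tuple R) :
  measurable_fun setT f -> measurable_fun setT g ->
  measurable_fun setT (fun t => vadd (f t) (g t)).
Proof.
move=> mf mg; apply: (@measurable_fun_tuple _ _ (fun i t => tnth (f t) i + tnth (g t) i)).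
  by move=> t i; rewrite tnth_mktuple.
by move=> i; apply: measurable_funD; exact: measurable_fun_tnth.
Qed.

Lemma measurable_vsub {k : nat} (f g : T -> k.-tuple R) :
  measurable_fun setT f -> measurable_fun setT g ->
  measurable_fun setT (fun t => vsub (f t) (g t)).
Proof.
move=> mf mg; apply: (@measurable_fun_tuple _ _ (fun i t => tnth (f t) i - tnth (g t) i)).
  by move=> t i; rewrite tnth_mktuple.
by move=> i; apply: measurable_funB; exact: measurable_fun_tnth.
Qed.

Lemma measurable_mulX {n p : nat} (X : 'M[R]_(n, p)) (f : T -> p.-tuple R) :
  measurable_fun setT f -> measurable_fun setT (fun t => mulX X (f t)).
Proof.
move=> mf; apply: (@measurable_fun_tuple _ _ (fun i t => \sum_(j < p) X i j * tnth (f t) j)).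
  by move=> t i; rewrite tnth_mktuple.
move=> i; apply: measurable_sum => j; apply: measurable_funM => //.
exact: measurable_fun_tnth.
Qed.

Lemma measurable_norm2 {k : nat} (f : T -> k.-tuple R) :
  measurable_fun setT f -> measurable_fun setT (fun t => norm2 (f t)).
Proof.
move=> mf; apply: measurable_fun_sqrt; apply: measurable_sum => i.
by apply: measurable_funX; exact: measurable_fun_tnth.
Qed.

Lemma measurable_lik {n p : nat} (sigma0 : R) (X : 'M[R]_(n, p))
    (b : T -> p.-tuple R) (y : T -> n.-tuple R) :
  measurable_fun setT b -> measurable_fun setT y ->
  measurable_fun setT (fun t => lik sigma0 X (b t) (y t)).
Proof.
move=> mb my; apply: measurable_funM => //; apply: measurableT_comp => //.
apply: measurable_funM => //; apply: measurable_funN; apply: measurable_funX.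
by apply: measurable_norm2; apply: measurable_vsub => //; exact: measurable_mulX.
Qed.

Lemma measurable_prior_beta {p : nat} (sigma0 : R) (A : {set 'I_p})
    (z lam xi : T -> p.-tuple R) (tau c2 eta : T -> R) :
  measurable_fun setT z -> measurable_fun setT lam -> measurable_fun setT xi ->
  measurable_fun setT tau -> measurable_fun setT c2 -> measurable_fun setT eta ->
  measurable_fun setT (fun t =>
    prior_beta sigma0 (z t) A (lam t) (xi t) (tau t) (c2 t) (eta t)).
Proof.
move=> mz mlam mxi mtau mc2 meta.
apply: (@measurable_fun_tuple _ _ (fun j t => if j \in A then
  sigma0 * Num.sqrt (kappa2 (tnth (z t) j) (tnth (lam t) j) (tau t) (c2 t) (eta t)) *
  tnth (xi t) j else 0)); first by move=> t j; rewrite tnth_mktuple.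
move=> j; case: (j \in A) => //.
apply: measurable_funM; last exact: measurable_fun_tnth.
apply: measurable_funM => //; apply: measurable_fun_sqrt.
have me : measurable_fun setT (fun t => expR (eta t * tnth (z t) j)).
  by apply: measurableT_comp => //; apply: measurable_funM => //; exact: measurable_fun_tnth.
have ml : measurable_fun setT (fun t => tnth (lam t) j ^+ 2).
  by apply: measurable_funX; exact: measurable_fun_tnth.
have mt : measurable_fun setT (fun t => tau t ^+ 2) by exact: measurable_funX.
apply: measurable_funM.
  by do 3 (apply: measurable_funM => //).
by apply: measurable_funV; apply: measurable_funD => //; do 2 (apply: measurable_funM => //).
Qed.

End model_measurability.

Section gaussian_noise.
Context {R : realType} {d : measure_display} {O : measurableType d}.
Context {n : nat} (P : probability O R) (sigma0 : R) (eps : O -> n.-tuple R).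
Hypotheses (sigma0_gt0 : 0 < sigma0) (noise : iid_gauss_noise P sigma0 eps).

Let meps : measurable_fun setT eps. Proof. by case: noise. Qed.

Let sigma0_neq0 : sigma0 != 0. Proof. by rewrite gt_eqF. Qed.

Definition shift_weight (a v : n.-tuple R) : R :=
  \prod_(i < n) normal_shift_weight sigma0 (tnth a i) (tnth v i).

Lemma shift_weight_ge0 a v : 0 <= shift_weight a v.
Proof. by apply: prodr_ge0 => i _; exact: expR_ge0. Qed.

Lemma measurable_shift_weight a : measurable_fun setT (shift_weight a).
Proof.
apply: measurable_prod => i _.
by apply: measurableT_comp; [exact: measurable_normal_shift_weight|exact: measurable_tnth].
Qed.

Let shift_weight_law (a : n.-tuple R) (B : set (n.-tuple R)) : measurable B ->
  (\int[P]_(w in eps @^-1` B) (shift_weight a (eps w))%:E =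
   P [set w | B (vadd a (eps w))])%E.
Proof.
have mW : measurable_fun setT (fun w => shift_weight a (eps w)).
  by apply: measurableT_comp meps; exact: measurable_shift_weight.
have mva : measurable_fun setT (fun w => vadd a (eps w)) by exact: measurable_vadd.
have [m1 m1E] := weighted_law_measure P _ _ (fun w => shift_weight_ge0 a (eps w)) mW meps.
have [m2 m2E] := weighted_law_measure P _ _ (fun=> ler01) (measurable_cst _) mva.
have {}m2E A : measurable A -> m2 A = P [set w | A (vadd a (eps w))].
  move=> mA; rewrite m2E integral_cst ?mul1e//.
  by rewrite -[X in measurable X]setTI; exact: mva.
have rect : forall A, tuple_rectangle A -> m1 A = m2 A.
  move=> _ [C mC ->].
  have mCa i : measurable [set x | C i (x + tnth a i)].
    rewrite -[X in measurable X]setTI.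
    by apply: (@measurable_funD _ _ _ setT id (cst (tnth a i))) => //.
  rewrite m1E m2E; last first.
    apply: measurable_forall_fin => i.
    by rewrite -[X in measurable X]setTI; exact: measurable_tnth.
  rewrite (_ : [set w | _] =
      [set w | forall i, [set x | C i (x + tnth a i)] (tnth (eps w) i)]); last first.
    by apply/seteqP; split=> w /= Cw i; have := Cw i; rewrite tnth_mktuple addrC.
  rewrite (noise.2 (fun i => [set x | C i (x + tnth a i)]) mCa) integral_mkcond.
  transitivity (\int[P]_w (\prod_(i < n) (\1_(C i) (tnth (eps w) i) *
      normal_shift_weight sigma0 (tnth a i) (tnth (eps w) i)))%:E)%E.
    apply: eq_integral => w _; rewrite patchE big_split/=.
    case: (asboolP (forall i, C i (tnth (eps w) i))) => [Cw|/existsNP[i nCi]].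
      by rewrite mem_set//= big1 ?mul1r// => i _; rewrite indicE mem_set//; exact: Cw.
    rewrite memNset/=; last by move/(_ i).
    by rewrite (bigD1 i)//= indicE memNset// !mul0r.
  rewrite (@integral_prod_law _ _ _ _ _ _ P (normal_prob 0 sigma0) eps meps noise.2
    (fun i x => \1_(C i) x * normal_shift_weight sigma0 (tnth a i) x)
    (fun i => fine (normal_prob 0 sigma0 [set x | C i (x + tnth a i)]))).
  - apply/esym; apply: (big_ind2 (fun x y => x = y%:E)) => // [x _ y _ -> ->//|i _].
    by rewrite fineK//; apply: fin_num_measure; exact: mCa.
  - by move=> i x; rewrite mulr_ge0// expR_ge0.
  - move=> i; apply: measurable_funM; first by apply: measurable_indic; exact: mC.
    exact: measurable_normal_shift_weight.
  - by move=> i; rewrite normal_prob_shift// fineK//; apply: fin_num_measure; exact: mCa.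
move=> mB; rewrite -m1E -m2E//.
have rectT : @tuple_rectangle _ R n setT by exists (fun=> setT) => //; apply/seteqP.
apply: (measure_unique tuple_rectangle (fun=> setT)) => //.
- exact: measurable_tuple_rectangleE.
- exact: setI_closed_tuple_rectangle.
- by rewrite bigcup_const.
- move=> _; rewrite rect// m2E//.
  by rewrite (_ : [set w | _] = setT) ?probability_setT ?ltry.
Qed.

Lemma integral_shift_noise (a : n.-tuple R) (g : n.-tuple R -> R) :
  (forall v, 0 <= g v) -> measurable_fun setT g ->
  (\int[P]_w (shift_weight a (eps w) * g (eps w))%:E =
   \int[P]_w (g (vadd a (eps w)))%:E)%E.
Proof.
move=> g0 mg.
have mva : measurable_fun setT (fun w => vadd a (eps w)) by exact: measurable_vadd.
have mW : measurable_fun setT (fun w => shift_weight a (eps w)).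
  by apply: measurableT_comp meps; exact: measurable_shift_weight.
have [m mE] := weighted_law_measure P _ _ (fun w => shift_weight_ge0 a (eps w)) mW meps.
rewrite (@ge0_integral_transfer _ _ _ _ _ P m (fun w => shift_weight a (eps w)) eps 1)//.
- rewrite mul1e.
  have := @ge0_integral_transfer _ _ _ _ _ P m (fun=> 1) (fun w => vadd a (eps w)) 1
    (fun=> ler01) (measurable_cst _) mva.
  move=> /(_ _ g g0 mg); rewrite mul1e => <-.
    by apply: eq_integral => w _; rewrite mul1r.
  move=> B mB; rewrite mul1e mE shift_weight_law//.
  under eq_integral do rewrite mul1r.
  by rewrite (integral_indic P measurableT (A := [set w | B (vadd a (eps w))])) ?setIT//
    -[X in measurable X]setTI; exact: mva.
- by move=> w; exact: shift_weight_ge0.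
- move=> B mB; rewrite mul1e mE [RHS]integral_mkcond/=.
  apply: eq_integral => w _; rewrite patchE indicE.
  have -> : (w \in eps @^-1` B) = (eps w \in B) by [].
  by case: ifP; rewrite ?mulr1 ?mulr0.
Qed.

Lemma lik_gt0 {p : nat} (X : 'M[R]_(n, p)) b y : 0 < lik sigma0 X b y.
Proof.
rewrite mulr_gt0 ?expR_gt0// exprn_gt0// invr_gt0 sqrtr_gt0 mulr_gt0//.
  by rewrite mulrn_wgt0// pi_gt0.
exact: exprn_gt0.
Qed.

Lemma lik_ratio_shift {p : nat} (X : 'M[R]_(n, p)) b b0 v :
  lik sigma0 X b (vadd (mulX X b0) v) / lik sigma0 X b0 (vadd (mulX X b0) v) =
  shift_weight (vsub (mulX X b) (mulX X b0)) v.
Proof.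
rewrite /lik -mulf_div divff ?mul1r; last first.
  by rewrite gt_eqF// exprn_gt0// invr_gt0 sqrtr_gt0 mulr_gt0 ?exprn_gt0// mulrn_wgt0// pi_gt0.
rewrite -expRB /shift_weight /normal_shift_weight -expR_sum; congr expR.
rewrite !sqr_sqrtr ?sumr_ge0// => [|? _|? _]; rewrite ?sqr_ge0//.
rewrite -mulrBl -[RHS]mulr_suml; congr (_ / _).
rewrite opprK addrC -sumrB; apply: eq_bigr => i _.
rewrite !tnth_mktuple; congr (_ ^+ 2 - _ ^+ 2).
  by rewrite addrC addrA addNr add0r.
by rewrite opprB addrA (addrC (tnth v i)).
Qed.

Lemma Ebeta_change_of_measure {p : nat} (X : 'M[R]_(n, p)) b b0 (g : n.-tuple R -> R) :
  (forall v, 0 <= g v) -> measurable_fun setT g ->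
  (\int[P]_w (let y := vadd (mulX X b0) (eps w) in
     g y * (lik sigma0 X b y / lik sigma0 X b0 y))%:E = Ebeta P X eps b g)%E.
Proof.
move=> g0 mg.
under eq_integral do rewrite /= lik_ratio_shift mulrC.
rewrite (@integral_shift_noise _ (fun v => g (vadd (mulX X b0) v)))//.
  apply: eq_integral => w _; congr (g _)%:E.
  by apply: eq_from_tnth => i; rewrite !tnth_mktuple addrA addrCA subrr addr0.
by apply: measurableT_comp => //; exact: measurable_vadd.
Qed.

End gaussian_noise.

(** * The posterior for a fixed screening outcome *)

Lemma markov_ge0 {R : realType} {d : measure_display} {T : measurableType d}
    (mu : {measure set T -> \bar R}) (g : T -> \bar R) (c : R) :
  0 < c -> measurable_fun setT g -> (forall x, 0 <= g x)%E ->
  (mu [set x | c%:E <= g x] <= c^-1%:E * \int[mu]_x g x)%E.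
Proof.
move=> c0 mg g0; have mE : measurable [set x | (c%:E <= g x)%E].
  by rewrite -[X in measurable X]setTI; exact: emeasurable_fun_c_infty.
rewrite lee_pdivlMl// -[X in (_ * mu X)%E]setIT -integral_indic// -ge0_integralZl//; last 2 first.
  - exact/measurable_EFinP/measurable_indic.
  - by rewrite lee_fin ltW.
apply: ge0_le_integral => //.
- by move=> x _; rewrite mule_ge0// lee_fin ltW.
- by apply: measurable_funeM; exact/measurable_EFinP/measurable_indic.
- move=> x _; rewrite indicE.
  by have [/set_mem|_] := boolP (x \in _); rewrite ?mule1 ?mule0.
Qed.

Lemma measurable_fine_integral {R : realType} {dT dW : measure_display}
    {Th : measurableType dT} {W : measurableType dW} (Q : probability Th R)
    (f : W * Th -> R) :
  measurable_fun setT f -> (forall x, 0 <= f x) ->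
  measurable_fun setT (fun w => fine (\int[Q]_th (f (w, th))%:E)%E).
Proof.
move=> mf f0; apply: measurableT_comp => //.
apply: (@measurable_fun_fubini_tonelli_F _ _ _ _ _ Q (fun x => (f x)%:E)) => //.
exact/measurable_EFinP.
Qed.

(* [active_posterior] for an arbitrary prior draw [b], convertible to it when [b] is
   [prior_beta]. *)
Definition posterior_tail {R : realType} {dT : measure_display} {Th : measurableType dT}
    (Q : probability Th R) {n p : nat} (sigma0 : R) (X : 'M[R]_(n, p)) (beta0 : p.-tuple R)
    (b : Th -> p.-tuple R) (y : n.-tuple R) (rad : R) : R :=
  fine (\int[Q]_th ((if rad <= norm2 (vsub (b th) beta0) then 1 else 0)
                      * lik sigma0 X (b th) y)%:E)%E
  / fine (\int[Q]_th (lik sigma0 X (b th) y)%:E)%E.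

Lemma measurable_posterior_tail {R : realType} {dT dW : measure_display}
    {Th : measurableType dT} {W : measurableType dW} (Q : probability Th R)
    {n p : nat} (sigma0 : R) (X : 'M[R]_(n, p)) (beta0 : p.-tuple R)
    (b : W * Th -> p.-tuple R) (y : W -> n.-tuple R) (rad : R) :
  0 < sigma0 -> measurable_fun setT b -> measurable_fun setT y ->
  measurable_fun setT (fun w =>
    posterior_tail Q sigma0 X beta0 (fun th => b (w, th)) (y w) rad).
Proof.
move=> sigma0_gt0 mb my.
have ml : measurable_fun setT (fun x => lik sigma0 X (b x) (y x.1)).
  by apply: measurable_lik => //; exact: measurableT_comp.
have l0 x : 0 <= lik sigma0 X (b x) (y x.1) by apply/ltW/lik_gt0.
apply: measurable_funM; last first.
  apply: measurable_funV.
  exact: (measurable_fine_integral Q (fun x => lik sigma0 X (b x) (y x.1))).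
apply: (measurable_fine_integral Q (fun x =>
  (if rad <= norm2 (vsub (b x) beta0) then 1 else 0) * lik sigma0 X (b x) (y x.1))).
  apply: measurable_funM => //; apply: measurable_fun_ifT => //.
  apply: measurable_fun_ler => //.
  by apply: measurable_norm2; exact: measurable_vsub.
by move=> x; rewrite mulr_ge0//; case: ifP.
Qed.

Section posterior_tail_bound.
Context {R : realType} {dO dT : measure_display}.
Context {O : measurableType dO} {Th : measurableType dT}.
Context (P : probability O R) (Q : probability Th R).
Context {n p : nat} (sigma0 : R) (X : 'M[R]_(n, p)) (beta0 : p.-tuple R).
Variables (eps : O -> n.-tuple R) (b : Th -> p.-tuple R).
Hypotheses (sigma0_gt0 : 0 < sigma0) (noise : iid_gauss_noise P sigma0 eps).
Hypothesis mb : measurable_fun setT b.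

Let y w := vadd (mulX X beta0) (eps w).
Let ratio th w := lik sigma0 X (b th) (y w) / lik sigma0 X beta0 (y w).

Let my : measurable_fun setT y.
Proof. by apply: measurable_vadd => //; case: noise. Qed.

Let ratio_ge0 th w : 0 <= ratio th w.
Proof. by rewrite divr_ge0// ltW// lik_gt0. Qed.

Let measurable_ratio : measurable_fun setT (fun x : O * Th => ratio x.2 x.1).
Proof.
have my1 : measurable_fun setT (fun x : O * Th => y x.1) by exact: measurableT_comp.
apply: measurable_funM; first by apply: measurable_lik => //; exact: measurableT_comp.
by apply: measurable_funV; exact: measurable_lik.
Qed.

Let lik_ratioE th w : lik sigma0 X (b th) (y w) = lik sigma0 X beta0 (y w) * ratio th w.
Proof. by rewrite mulrC divfK// gt_eqF// lik_gt0. Qed.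

Let measurable_ratio_th w : measurable_fun setT (fun th => ratio th w).
Proof. by apply: measurable_funM => //; exact: measurable_lik. Qed.

Let lik_le (b' : p.-tuple R) y' :
  lik sigma0 X b' y' <= (Num.sqrt (pi *+ 2 * sigma0 ^+ 2))^-1 ^+ n.
Proof.
rewrite ler_piMr// ?exprn_ge0 ?invr_ge0 ?sqrtr_ge0//.
by rewrite -expR0 ler_expR mulNr oppr_le0 divr_ge0 ?sqr_ge0// mulrn_wge0// sqr_ge0.
Qed.

Variables (phi : n.-tuple R -> R) (Om : set O) (rad T a e : R).
Hypotheses (mphi : measurable_fun setT phi) (phi01 : forall v, 0 <= phi v <= 1).
Hypotheses (mOm : measurable Om) (a0 : 0 < a) (e0 : 0 < e) (T0 : 0 <= T).
Hypothesis test_bound : forall th, rad <= norm2 (vsub (b th) beta0) ->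
  (Ebeta P X eps (b th) (fun v => (1 - phi v)%R) <= T%:E)%E.
Hypothesis evidence_bound : forall w, Om w ->
  (a%:E <= \int[Q]_th (lik sigma0 X (b th) (y w) / lik sigma0 X beta0 (y w))%:E)%E.

Let far th : R := if rad <= norm2 (vsub (b th) beta0) then 1 else 0.

Let far_ge0 th : 0 <= far th. Proof. by rewrite /far; case: ifP. Qed.

Let measurable_far : measurable_fun setT far.
Proof.
apply: measurable_fun_ifT => //; apply: measurable_fun_ler => //.
by apply: measurable_norm2; exact: measurable_vsub.
Qed.

Let far_mass w := (\int[Q]_th (far th * ratio th w)%:E)%E.

Let posterior_tail_far_mass w : Om w ->
  e < posterior_tail Q sigma0 X beta0 b (y w) rad -> ((e * a)%:E <= far_mass w)%E.
Proof.
move=> Omw; set f0 := lik sigma0 X beta0 (y w).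
have f0_gt0 : 0 < f0 by exact: lik_gt0.
have intE (g : Th -> R) : measurable_fun setT g -> (forall th, 0 <= g th) ->
    (\int[Q]_th (g th * lik sigma0 X (b th) (y w))%:E =
     f0%:E * \int[Q]_th (g th * ratio th w)%:E)%E.
  move=> mg g0; rewrite -ge0_integralZl//.
  - by apply: eq_integral => th _; rewrite lik_ratioE mulrCA EFinM.
  - by apply/measurable_EFinP; apply: measurable_funM.
  - by move=> th _; rewrite lee_fin mulr_ge0.
  - by rewrite lee_fin ltW.
have intfin (g : Th -> R) : measurable_fun setT g -> (forall th, 0 <= g th <= 1) ->
    (\int[Q]_th (g th * ratio th w)%:E)%E \is a fin_num.
  move=> mg g01; have g0 th : 0 <= g th by case/andP: (g01 th).
  have : (f0%:E * \int[Q]_th (g th * ratio th w)%:E)%E \is a fin_num.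
    rewrite -intE// ge0_fin_numE; last first.
      by apply: integral_ge0 => th _; rewrite lee_fin mulr_ge0// ltW// lik_gt0.
    apply: (@le_lt_trans _ _
      (\int[Q]_th ((Num.sqrt (pi *+ 2 * sigma0 ^+ 2))^-1 ^+ n)%:E)%E); last first.
      by rewrite integral_cst//= probability_setT mule1 ltry.
    apply: ge0_le_integral => //.
    - by move=> th _; rewrite lee_fin mulr_ge0// ltW// lik_gt0.
    - by apply/measurable_EFinP; apply: measurable_funM => //; exact: measurable_lik.
    - move=> th _; rewrite lee_fin (le_trans _ (lik_le (b th) (y w)))//.
      by rewrite ler_piMl ?(andP (g01 th)).2// ltW// lik_gt0.
  have : (0 <= \int[Q]_th (g th * ratio th w)%:E)%E.
    by apply: integral_ge0 => th _; rewrite lee_fin mulr_ge0.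
  case: (integral _ _ _) => // _.
  by rewrite gt0_muley// lte_fin.
rewrite /posterior_tail -/far (intE far)//.
have -> : (\int[Q]_th (lik sigma0 X (b th) (y w))%:E =
     f0%:E * \int[Q]_th (ratio th w)%:E)%E.
  rewrite -[RHS](_ : f0%:E * \int[Q]_th (1 * ratio th w)%:E = _)%E.
    by rewrite -intE//; apply: eq_integral => th _; rewrite mul1r.
  by congr (_ * _)%E; apply: eq_integral => th _; rewrite mul1r.
have far01 th : 0 <= far th <= 1 by rewrite /far; case: ifP; rewrite ?lexx ?ler01.
have Ffin := intfin far measurable_far far01.
have Efin : (\int[Q]_th (ratio th w)%:E)%E \is a fin_num.
  rewrite (_ : (\int[Q]_th _)%E = (\int[Q]_th (1 * ratio th w)%:E)%E).
    by apply: (intfin (fun=> 1)) => // th; rewrite ler01 lexx.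
  by apply: eq_integral => th _; rewrite mul1r.
have aE : a <= fine (\int[Q]_th (ratio th w)%:E)%E.
  by rewrite -lee_fin fineK//; exact: evidence_bound.
rewrite !fineM//= -mulf_div divff ?gt_eqF// mul1r ltr_pdivlMr; last exact: lt_le_trans aE.
move=> h; rewrite /far_mass -(fineK Ffin) lee_fin (le_trans _ (ltW h))//.
by rewrite ler_pM2l.
Qed.

Let measurable_far_mass : measurable_fun setT far_mass.
Proof.
apply: (@measurable_fun_fubini_tonelli_F _ _ _ _ _ Q
  (fun x : O * Th => (far x.2 * ratio x.2 x.1)%:E)).
  by apply/measurable_EFinP/measurable_funM => //; exact: measurableT_comp.
by move=> x; rewrite lee_fin mulr_ge0.
Qed.

Let phi1_ge0 v : 0 <= 1 - phi v. Proof. by rewrite subr_ge0; case/andP: (phi01 v). Qed.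

(* Tonelli turns the prior average of the likelihood ratios into type II errors. *)
Let integral_far_mass : (\int[P]_w ((1 - phi (y w))%:E * far_mass w) <= T%:E)%E.
Proof.
have mphi1 : measurable_fun setT (fun v => 1 - phi v) by exact: measurable_funB.
pose F (x : O * Th) := ((1 - phi (y x.1)) * (far x.2 * ratio x.2 x.1))%:E.
have mF : measurable_fun setT F.
  apply/measurable_EFinP/measurable_funM; last first.
    by apply: measurable_funM => //; exact: measurableT_comp.
  by apply: (measurableT_comp mphi1); exact: measurableT_comp.
have F0 x : (0 <= F x)%E by rewrite lee_fin mulr_ge0// mulr_ge0.
rewrite (_ : (\int[P]_w _)%E = (\int[P]_w \int[Q]_th F (w, th))%E); last first.
  apply: eq_integral => w _; rewrite /far_mass -ge0_integralZl//.
  - by apply/measurable_EFinP/measurable_funM.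
  - by move=> th _; rewrite lee_fin mulr_ge0.
  - by rewrite lee_fin.
rewrite (fubini_tonelli F)//.
apply: (@le_trans _ _ (\int[Q]_th T%:E)%E); last first.
  by rewrite integral_cst//= probability_setT mule1.
apply: ge0_le_integral => //.
- by move=> th _; apply: integral_ge0.
- exact: (@measurable_fun_fubini_tonelli_G _ _ _ _ _ P F).
move=> th _; rewrite /F /=.
have [farth|nfar] := boolP (rad <= norm2 (vsub (b th) beta0)); last first.
  rewrite integral0_eq// => w _; by rewrite /far (negPf nfar) mul0r mulr0.
apply: le_trans (test_bound _ farth).
rewrite -(@Ebeta_change_of_measure _ _ _ _ P sigma0 eps _ _ _ X (b th) beta0)//.
by under eq_integral do rewrite /far farth mul1r.
Qed.

Lemma posterior_tail_probability_le :
  (P [set w | (e < posterior_tail Q sigma0 X beta0 b (y w) rad)%R] <=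
   P (~` Om) + 2%:E * Ebeta P X eps beta0 phi + ((e * a / 2)^-1 * T)%:E)%E.
Proof.
have mpost : measurable [set w | e < posterior_tail Q sigma0 X beta0 b (y w) rad].
  rewrite -[X in measurable X]setTI.
  apply: (@measurable_fun_ltr _ _ _ setT (cst e)
    (fun w => posterior_tail Q sigma0 X beta0 b (y w) rad)) => //.
  apply: (@measurable_posterior_tail _ _ _ _ _ Q _ _ sigma0 X beta0 (fun x => b x.2) y) => //.
  exact: measurableT_comp.
have mphiy : measurable_fun setT (fun w => (phi (y w))%:E).
  by apply/measurable_EFinP; exact: measurableT_comp.
have mg : measurable_fun setT (fun w => (1 - phi (y w))%:E * far_mass w)%E.
  apply: emeasurable_funM => //; apply/measurable_EFinP.
  by apply: measurable_funB => //; exact: measurableT_comp.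
have fm0 w : (0 <= far_mass w)%E by apply: integral_ge0 => th _; rewrite lee_fin mulr_ge0.
have phi0 v : 0 <= phi v by case/andP: (phi01 v).
have g0 w : (0 <= (1 - phi (y w))%:E * far_mass w)%E by rewrite mule_ge0// lee_fin.
pose S1 := [set w | (2^-1%:E <= (phi (y w))%:E)%E].
pose S2 := [set w | ((e * a / 2)%:E <= (1 - phi (y w))%:E * far_mass w)%E].
have mS1 : measurable S1 by rewrite -[X in measurable X]setTI; exact: emeasurable_fun_c_infty.
have mS2 : measurable S2 by rewrite -[X in measurable X]setTI; exact: emeasurable_fun_c_infty.
have mOmC : measurable (~` Om) by exact: measurableC.
apply: (@le_trans _ _ (P (~` Om `|` S1 `|` S2))).
  apply: le_measure; rewrite ?inE//; first by apply: measurableU => //; exact: measurableU.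
  move=> w /= ew; have [Omw|] := pselect (Om w); last by left; left.
  have [phiw|phiw] := leP 2^-1 (phi (y w)); first by left; right; rewrite /S1/= lee_fin.
  right; rewrite /S2/= mulrC EFinM; apply: lee_pmul.
  - by rewrite lee_fin invr_ge0.
  - by rewrite lee_fin mulr_ge0// ltW.
  - by rewrite lee_fin; move: (phi _) phiw => x; lra.
  - exact: posterior_tail_far_mass.
apply: (le_trans (measureU2 _ _ _)) => //; first exact: measurableU.
apply: leeD.
  apply: (le_trans (measureU2 _ _ _)) => //; apply: leeD => //.
  have := @markov_ge0 _ _ _ P _ (2^-1) _ mphiy (fun w => phi0 (y w)).
  by rewrite invrK; apply; rewrite invr_gt0.
apply: (le_trans (markov_ge0 P _ _ _ mg g0)); first by rewrite divr_gt0// mulr_gt0.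
by rewrite EFinM lee_wpmul2l// lee_fin invr_ge0 divr_ge0// mulr_ge0// ltW.
Qed.

End posterior_tail_bound.

(** * Averaging over the screening *)

Lemma ge0_cvge0P {R : realType} (x : nat -> \bar R) : (forall n, 0 <= x n)%E ->
  x @ \oo --> 0%E <-> forall c : R, 0 < c -> \forall n \near \oo, (x n <= c%:E)%E.
Proof.
move=> x0; split=> [x_0 c c0|x_0].
  have /x_0 : nbhs (0 : \bar R)%E [set z | (z <= c%:E)%E].
    exists c => //= r; rewrite /ball_/= sub0r normrN lee_fin => /ltW.
    exact: le_trans (ler_norm _).
  by [].
have xfin : \forall n \near \oo, x n \is a fin_num.
  near=> n; rewrite ge0_fin_numE//; apply: (@le_lt_trans _ _ 1%E); last exact: ltry.
  by near: n; exact: x_0.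
apply/fine_cvgP; split=> //; apply/cvgr0Pnorm_le => c c0; near=> n.
rewrite /= ger0_norm ?fine_ge0// -lee_fin fineK; last by near: n.
by near: n; exact: x_0.
Unshelve. all: by end_near. Qed.

Lemma probability_setC_near {R : realType} {d : measure_display} {T : measurableType d}
    (P : probability T R) (A : nat -> set T) (c : R) :
  (forall n, measurable (A n)) -> (fun n => P (A n)) @ \oo --> 1%E -> 0 < c ->
  \forall n \near \oo, (P (~` A n) <= c%:E)%E.
Proof.
move=> mA PA1 c0; apply: (ge0_cvge0P _ _).1 c0 => //.
under eq_fun do rewrite probability_setC//.
rewrite -(subee (x := 1%E))//; apply: cvgeB => //; exact: cvg_cst.
Qed.

Lemma xsection_set {T U : Type} (A : set (T * U)) x : xsection A x = [set y | A (x, y)].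
Proof. by apply/seteqP; split=> y; rewrite /xsection/= inE. Qed.

Lemma measurable_active_posterior_gt {R : realType} {dA dN dT : measure_display}
    {OA : measurableType dA} {ON : measurableType dN} {Th : measurableType dT}
    (Q : probability Th R) {n p : nat} (sigma0 : R) (X : 'M[R]_(n, p)) (beta0 : p.-tuple R)
    (lam xi : Th -> p.-tuple R) (tau c2 eta : Th -> R)
    (z : OA -> p.-tuple R) (A : OA -> {set 'I_p}) (y : ON -> n.-tuple R) (rad e : R) :
  0 < sigma0 ->
  measurable_fun setT lam -> measurable_fun setT xi -> measurable_fun setT tau ->
  measurable_fun setT c2 -> measurable_fun setT eta -> measurable_fun setT z ->
  (forall S, measurable [set w | A w = S]) -> measurable_fun setT y ->
  measurable [set w : OA * ON | e < active_posterior Q sigma0 X beta0 lam xi tau c2 eta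
                                  (z w.1) (A w.1) (y w.2) rad].
Proof.
move=> sigma0_gt0 mlam mxi mtau mc2 meta mz mA my.
rewrite (_ : [set w | _] = [set w | forall S, (~` [set w | A w.1 = S] `|`
    [set w | e < active_posterior Q sigma0 X beta0 lam xi tau c2 eta
                   (z w.1) S (y w.2) rad]) w]); last first.
  apply/seteqP; split=> w /=.
    by move=> ew S; have [<-|] := pselect (A w.1 = S); [right|left].
  by move=> /(_ (A w.1)) [].
apply: measurable_forall_fin => S; apply: measurableU.
  apply: measurableC; rewrite -[X in measurable X]setTI.
  exact: (@measurable_fst _ _ OA ON measurableT _ (mA S)).
rewrite -[X in measurable X]setTI.
apply: (@measurable_fun_ltr _ _ _ setT (cst e)) => //.
apply: (@measurable_posterior_tail _ _ _ _ _ Q _ _ sigma0 X beta0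
  (fun x : (OA * ON) * Th => prior_beta sigma0 (z x.1.1) S (lam x.2) (xi x.2)
     (tau x.2) (c2 x.2) (eta x.2)) (fun w => y w.2)) => //; last exact: measurableT_comp.
apply: measurable_prior_beta; try exact: measurableT_comp.
by apply: (measurableT_comp mz); exact: measurableT_comp.
Qed.

Lemma inTheta_prior_beta {R : realType} {p : nat} (sigma0 : R) (z : p.-tuple R)
    (A : {set 'I_p}) lam xi tau c2 eta :
  inTheta A (prior_beta sigma0 z A lam xi tau c2 eta).
Proof. by move=> j jA; rewrite tnth_mktuple (negPf jA). Qed.

Lemma tail_rate_near {R : realType} (k : nat -> R) (e delta c : R) :
  0 < e -> 0 < delta -> 0 < c -> k @ \oo --> +oo ->
  \forall n \near \oo, e * expR (- delta * k n) <= c.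
Proof.
move=> e0 delta0 c0 /cvgryPge kE; near=> n.
rewrite -ler_pdivlMl// -[leRHS]lnK ?posrE ?mulr_gt0 ?invr_gt0//.
rewrite ler_expR mulNr lerNl -ler_pdivrMl//.
by near: n; exact: kE.
Unshelve. all: by end_near. Qed.

Theorem theorem3
  (R : realType) (dA dN dT : measure_display)
  (* screening / auxiliary data space *)
  (OA : measurableType dA) (PA : probability OA R)
  (* noise space: y = X beta0 + eps *)
  (ON : measurableType dN) (PN : probability ON R)
  (* prior space carrying the guided-prior random variables *)
  (Th : measurableType dT) (Q : probability Th R)
  (p : nat -> nat) (X : forall n, 'M[R]_(n, p n)) (beta0 : forall n, (p n).-tuple R)
  (sigma0 : R) (eps : forall n, ON -> n.-tuple R)
  (zt : forall n, OA -> (p n).-tuple R) (An : forall n, OA -> {set 'I_(p n)})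
  (binit : forall n, OA -> (p n).-tuple R)
  (tau0 a_c b_c sigma_eta : R)
  (lam xi : forall n, Th -> (p n).-tuple R) (tau c2 eta : nat -> Th -> R)
  (t u r q L : nat -> R) (Cm CF CD : R) (cT : R -> R) :
  let S0 n := vsupp (beta0 n) in
  let s0 n : R := #|S0 n|%:R in
  let m n := Cm * s0 n * L n in
  let eb n := Num.sqrt (s0 n * ln (m n) / n%:R) in
  let y n (w : ON) := vadd (mulX (X n) (beta0 n)) (eps n w) in
  (* model / measurability *)
  0 < sigma0 ->
  (forall n, iid_gauss_noise PN sigma0 (eps n)) ->
  (forall n, measurable_fun setT (zt n) /\ measurable_fun setT (binit n) /\
             (forall S, measurable [set w | An n w = S])) ->
  (forall n, guided_prior_law Q tau0 a_c b_c sigma_eta (lam n) (xi n) (tau n) (c2 n) (eta n)) ->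
  (* (A1) *)
  (fun n => s0 n * ln (p n)%:R / n%:R) @ \oo --> 0 ->
  (fun n => s0 n * ln (p n)%:R) @ \oo --> +oo ->
  (* (A2) *)
  (exists phi0 K, 0 < phi0 /\ 1 <= K /\
     forall n (v : (p n).-tuple R), #|vsupp v|%:R <= K * s0 n ->
       n%:R * phi0 ^+ 2 * norm2 v ^+ 2 <= norm2 (mulX (X n) v) ^+ 2) ->
  (* (A4) *)
  (exists Cz, forall n w j, `|tnth (zt n w) j| <= Cz) ->
  (* (A5) *)
  (exists B, forall n j, j \in S0 n -> `|tnth (beta0 n) j| <= B) ->
  (* (A6) *)
  0 < tau0 -> 0 < a_c -> 0 < b_c -> 0 < sigma_eta ->
  (* (A9) *)
  (fun n => (p n)%:R : R) @ \oo --> +oo ->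
  (fun n => ln ((p n)%:R : R) / n%:R) @ \oo --> 0 ->
  (* (A11) *)
  (exists C, \forall n \near \oo, forall v : (p n).-tuple R,
       norm2 (mulX (X n) v) <= C * Num.sqrt n%:R * norm2 v) ->
  (* (B1) *)
  (forall n w j, t n < `|tnth (binit n w) j| \/ u n < tnth (zt n w) j -> j \in An n w) ->
  (* (B2) *)
  (forall n, t n < r n /\ u n < q n) ->
  (fun n => PA [set w | forall j, j \in S0 n -> r n <= `|tnth (binit n w) j|]) @ \oo --> 1%E ->
  (fun n => PA [set w | forall j, j \in S0 n -> q n <= tnth (zt n w) j]) @ \oo --> 1%E ->
  (* (B3) *)
  (exists (k : nat) C1, \forall n \near \oo, L n <= C1 * ln ((p n)%:R : R) ^+ k) ->
  0 < Cm ->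
  (fun n => PA [set w | #|An n w|%:R <= m n]) @ \oo --> 1%E ->
  (* (B4) *)
  (exists M1, forall M, M1 <= M ->
     exists phi : forall n, n.-tuple R -> R,
       (forall n, measurable_fun setT (phi n)) /\
       (forall n v, 0 <= phi n v <= 1) /\
       (fun n => Ebeta PN (X n) (eps n) (beta0 n) (phi n)) @ \oo --> 0%E /\
       (forall n A, in_calA (S0 n) (m n) A ->
        forall beta, inTheta A beta -> M * eb n <= norm2 (vsub beta (beta0 n)) ->
          (Ebeta PN (X n) (eps n) beta (fun v => (1 - phi n v)%R)
             <= (expR (- cT M * n%:R * eb n ^+ 2))%:E)%E)) ->
  (* s0 log m_n -> oo *)
  (fun n => s0 n * ln (m n)) @ \oo --> +oo ->
  (* sieve condition *)
  0 < CF ->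
  (forall n w A, in_calA (S0 n) (m n) A ->
     exists F : set ((p n).-tuple R), measurable F /\ F `<=` inTheta A /\
       (Q [set th | ~ F (prior_beta sigma0 (zt n w) A (lam n th) (xi n th)
                                   (tau n th) (c2 n th) (eta n th))]
          <= (expR (- CF * n%:R * eb n ^+ 2))%:E)%E) ->
  (* evidence lower bound *)
  0 < CD ->
  (forall delta, 0 < delta ->
     exists Om : forall n, {set 'I_(p n)} -> set (OA * ON),
       (forall n A, measurable (Om n A)) /\
       (forall wA e, 0 < e -> \forall n \near \oo, forall A, in_calA (S0 n) (m n) A ->
          (PN [set wN | ~ Om n A (wA, wN)] <= e%:E)%E) /\
       (forall n A, in_calA (S0 n) (m n) A -> forall w, Om n A w ->
          ((expR (- (CD + delta) * n%:R * eb n ^+ 2))%:E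
            <= evidence Q sigma0 (X n) (beta0 n) (lam n) (xi n) (tau n) (c2 n) (eta n)
                        (zt n w.1) A (y n w.2))%E)) ->
  (* min{c_T(M), C_F} > C_D for large M *)
  (exists M2, forall M, M2 <= M -> CD < cT M /\ CD < CF) ->
  (* conclusion *)
  exists M0, forall M, M0 <= M -> forall e, 0 < e ->
    (fun n => (PA \x PN)%E
       [set w | e < active_posterior Q sigma0 (X n) (beta0 n) (lam n) (xi n) (tau n) (c2 n) (eta n)
                      (zt n w.1) (An n w.1) (y n w.2) (M * eb n)]) @ \oo --> 0%E.
Proof.
move=> S0 s0 m eb y sigma0_gt0 noise mscreen prior _ _ _ _ _ _ _ _ _ _ _ _ B1 B2
  B2r _ _ _ B3 [M1 tests] s0m _ _ _ evidence_lb [M2 cTCD].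
exists (Num.max M1 M2) => M; rewrite ge_max => /andP[M1M M2M] e e0.
have [phi [mphi [phi01 [phi_null phi_alt]]]] := tests M M1M.
have [CDcT _] := cTCD M M2M.
pose delta := (cT M - CD) / 2.
have delta0 : 0 < delta by rewrite divr_gt0// subr_gt0.
have [Om [mOm [Om_near Om_ev]]] := evidence_lb delta delta0.
have my n : measurable_fun setT (y n) by apply: measurable_vadd => //; case: (noise n).
pose S n := [set w : OA * ON | e < active_posterior Q sigma0 (X n) (beta0 n)
  (lam n) (xi n) (tau n) (c2 n) (eta n) (zt n w.1) (An n w.1) (y n w.2) (M * eb n)].
have mS n : measurable (S n).
  have [mz [_ mA]] := mscreen n.
  have [[mlam [mxi [mtau [mc2 meta]]]] _] := prior n.
  exact: measurable_active_posterior_gt.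
pose Gr n := [set w | forall j, j \in S0 n -> r n <= `|tnth (binit n w) j|].
pose Gm n := [set w | #|An n w|%:R <= m n].
pose G n := Gr n `&` Gm n.
have mGr n : measurable (Gr n).
  have [_ [mb _]] := mscreen n.
  apply: (measurable_forall_fin _
    (fun j => [set w | j \in S0 n -> r n <= `|tnth (binit n w) j|])) => j.
  case: (j \in S0 n); last first.
    by rewrite (_ : [set x | _] = setT)//; apply/seteqP; split.
  rewrite (_ : [set x | _] = setT `&` [set w | r n <= `|tnth (binit n w) j|]); last first.
    by rewrite setTI; apply/seteqP; split=> w /= h; [exact: h|move=> _].
  apply: (@measurable_fun_ler _ _ _ setT (cst (r n))) => //.
  by apply: measurableT_comp => //; exact: measurable_fun_tnth.
have mGm n : measurable (Gm n).
  rewrite (_ : Gm n = [set w | forall A, (~` [set w | An n w = A] `|`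
      [set _ | #|A|%:R <= m n]) w]); last first.
    apply/seteqP; split=> w /=.
      by move=> mw A; have [<-|] := pselect (An n w = A); [right|left].
    by move=> /(_ (An n w)) [].
  apply: measurable_forall_fin => A; have [_ [_ mA]] := mscreen n.
  apply: measurableU; first by apply: measurableC.
  by case: (#|A|%:R <= m n); [rewrite (_ : [set _ | _] = setT)|rewrite (_ : [set _ | _] = set0)]
    => //; apply/seteqP; split.
have mG n : measurable (G n) by exact: measurableI.
have GA n w : G n w -> in_calA (S0 n) (m n) (An n w).
  move=> [rw mw]; split=> //; apply/fintype.subsetP => j jS; apply: B1; left.
  by apply: lt_le_trans (rw j jS); have [] := B2 n.
pose h n wA := PN (xsection (S n) wA).
have h_ge0 n wA : (0 <= h n wA)%E by [].
have h_le1 n wA : (h n wA <= 1)%E by apply: probability_le1; exact: measurable_xsection.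
have mh n : measurable_fun setT (h n) by exact: measurable_fun_xsection.
pose hG n wA := (h n wA * (\1_(G n) wA)%:E)%E.
have mhG n : measurable_fun setT (hG n).
  by apply: emeasurable_funM => //; exact/measurable_EFinP/measurable_indic.
have hG_ge0 n wA : (0 <= hG n wA)%E by rewrite mule_ge0// lee_fin.
have hG_le1 n wA : (hG n wA <= 1)%E.
  by rewrite /hG indicE; case: (_ \in _); rewrite ?mule1 ?mule0.
have hG_cvg wA : hG n wA @[n --> \oo] --> 0%E.
  apply/ge0_cvge0P => // c c0.
  have c3 : 0 < c / 3 by rewrite divr_gt0.
  have c6 : 0 < c / 6 by rewrite divr_gt0.
  have e2 : 0 < 2 / e by rewrite divr_gt0.
  have phi_near : \forall n \near \oo,
      (Ebeta PN (X n) (eps n) (beta0 n) (phi n) <= (c / 6)%:E)%E.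
    apply: (ge0_cvge0P _ _).1 c6 => // n; apply: integral_ge0 => w _.
    by rewrite lee_fin; case/andP: (phi01 n (vadd (mulX (X n) (beta0 n)) (eps n w))).
  have rate_near := tail_rate_near _ _ _ _ e2 delta0 c3 s0m.
  near=> n.
  have OmA : forall A, in_calA (S0 n) (m n) A ->
      (PN [set wN | ~ Om n A (wA, wN)] <= (c / 3)%:E)%E by near: n; exact: Om_near.
  have rate_n : 2 / e * expR (- delta * (s0 n * ln (m n))) <= c / 3 by near: n.
  rewrite /hG indicE; have [/set_mem Gw|_] := boolP (wA \in G n); last first.
    by rewrite mule0 lee_fin ltW.
  rewrite mule1; set A := An n wA; have calA := GA _ _ Gw.
  pose Om' := [set wN | Om n A (wA, wN)].
  have mOm' : measurable Om' by rewrite /Om' -xsection_set; exact: measurable_xsection.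
  pose b th := prior_beta sigma0 (zt n wA) A (lam n th) (xi n th) (tau n th) (c2 n th) (eta n th).
  have mb : measurable_fun setT b.
    have [[mlam [mxi [mtau [mc2 meta]]]] _] := prior n.
    exact: measurable_prior_beta.
  have := @posterior_tail_probability_le _ _ _ _ _ PN Q n (p n) sigma0 (X n) (beta0 n)
    (eps n) b sigma0_gt0 (noise n) mb (phi n) Om' (M * eb n)
    (expR (- cT M * n%:R * eb n ^+ 2)) (expR (- (CD + delta) * n%:R * eb n ^+ 2)) e
    (mphi n) (phi01 n) mOm' (expR_gt0 _) e0 (expR_ge0 _).
  move=> /(_ _ _)/le_trans; rewrite /h xsection_set; apply.
  - by move=> th farth; apply: (phi_alt n A) => //; exact: inTheta_prior_beta.
  - by move=> wN Omw; exact: (Om_ev n A calA (wA, wN) Omw).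
  have -> : c%:E = ((c / 3)%:E + 2%:E * (c / 6)%:E + (c / 3)%:E)%E.
    by rewrite -EFinM -!EFinD; congr (_%:E); lra.
  apply: leeD; first apply: leeD.
  - exact: OmA.
  - by rewrite lee_wpmul2l ?lee_fin//; near: n.
  rewrite lee_fin.
  have neb : n%:R * eb n ^+ 2 = s0 n * ln (m n).
    rewrite sqr_sqrtr.
      rewrite mulrC divfK// pnatr_eq0 -lt0n; near: n; exact: nbhs_infty_gt.
    rewrite divr_ge0//; near: n.
    by move/cvgryPge : s0m; exact.
  rewrite -!mulrA neb.
  rewrite (_ : - cT M * (s0 n * ln (m n)) =
      - (CD + delta) * (s0 n * ln (m n)) + - delta * (s0 n * ln (m n))); last first.
    by rewrite /delta; field.
  rewrite expRD; set a := expR (- (CD + delta) * _); set rate := expR _.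
  rewrite (_ : _ * (a * rate) = 2 / e * rate); last first.
    by field; apply/andP; split; rewrite gt_eqF ?expR_gt0.
  exact: rate_n.
have int_hG : (\int[PA]_wA hG n wA)%E @[n --> \oo] --> 0%E.
  rewrite -(integral0 PA setT).
  apply: (@dominated_cvg _ _ _ PA setT measurableT hG (cst 0%E) (cst 1%E)) => //.
  - by move=> x _; exact: hG_cvg.
  - exact: (@finite_measure_integrable_cst _ _ _ PA setT 1 measurableT).
  - by move=> n x _; rewrite gee0_abs.
apply/ge0_cvge0P => // c c0.
have c_half : 0 < c / 2 by rewrite divr_gt0.
have c4 : 0 < c / 4 by rewrite divr_gt0.
have Gr_near := probability_setC_near _ _ _ mGr B2r c4.
have Gm_near := probability_setC_near _ _ _ mGm B3 c4.
have int_near : \forall n \near \oo, (\int[PA]_wA hG n wA <= (c / 2)%:E)%E.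
  by apply: (ge0_cvge0P _ _).1 c_half => // n; exact: integral_ge0.
near=> n; rewrite -/(S n).
have -> : c%:E = ((c / 2)%:E + ((c / 4)%:E + (c / 4)%:E))%E.
  by rewrite -!EFinD; congr (_%:E); field.
apply: (@le_trans _ _ (\int[PA]_wA (hG n wA + (\1_(~` G n) wA)%:E))%E).
  rewrite /product_measure1; apply: ge0_le_integral => //.
  - exact: mh.
  - apply: emeasurable_funD => //.
    by apply/measurable_EFinP/measurable_indic; exact: measurableC.
  - move=> wA _; rewrite /hG !indicE in_setC; case: (wA \in G n) => /=.
      by rewrite mule1 adde0.
    by rewrite mule0 add0e; exact: h_le1.
rewrite ge0_integralD//; last first.
  by apply/measurable_EFinP/measurable_indic; exact: measurableC.
rewrite integral_indic// ?setIT; last exact: measurableC.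
apply: leeD; first by near: n.
rewrite setCI; apply: (le_trans (measureU2 _ _ _)) => //; try exact: measurableC.
by apply: leeD; near: n.
Unshelve. all: by end_near. Qed.
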